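(* Let $V$ be a unitary $(\mathfrak g,K)$-module with inner product $(\cdot,\cdot)$, and let $V^+$ be the span of its $K$-highest weight vectors. The adjoints, with respect to the restriction of $(\cdot,\cdot)$ to $V^+$, of the operators $A_\delta,B_\delta:V^+\to V^+$ are $$A_\beta^*=-B_\beta(H_\alpha+2)(H_\gamma+2),\qquad B_\beta^*=-A_\beta\frac1{(H_\alpha+1)(H_\gamma+1)},$$ $$A_{\alpha+\beta}^*=-B_{\alpha+\beta}\frac{H_\gamma+2}{H_\alpha+1},\qquad B_{\alpha+\beta}^*=-A_{\alpha+\beta}\frac{H_\alpha+2}{H_\gamma+1},$$ $$A_{\beta+\gamma}^*=-B_{\beta+\gamma}\frac{H_\alpha+2}{H_\gamma+1},\qquad B_{\beta+\gamma}^*=-A_{\beta+\gamma}\frac{H_\gamma+2}{H_\alpha+1},$$ $$A_{\alpha+\beta+\gamma}^*=-B_{\alpha+\beta+\gamma}\frac1{(H_\alpha+1)(H_\gamma+1)},\qquad B_{\alpha+\beta+\gamma}^*=-A_{\alpha+\beta+\gamma}(H_\alpha+2)(H_\gamma+2).$$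
   Context: Let $\mathfrak g=\mathfrak{sl}(4,\mathbb C)$ with matrix units $E_{ij}$, and let $K=S(U(2)\times U(2))$ (block diagonal) be the maximal compact subgroup of $SU(2,2)$. Let $\mathfrak g_0=\mathfrak{su}(2,2)=\{X\in M_4(\mathbb C): \operatorname{tr}X=0,\ \overline{X}^{t}J+JX=0\}$ with $J=\operatorname{diag}(1,1,-1,-1)$. Put $H_\alpha=E_{11}-E_{22}$, $H_\beta=E_{22}-E_{33}$, $H_\gamma=E_{33}-E_{44}$; $X_\alpha=E_{12}$, $X_\beta=E_{23}$, $X_\gamma=E_{34}$, $X_{\alpha+\beta}=E_{13}$, $X_{\beta+\gamma}=E_{24}$, $X_{\alpha+\beta+\gamma}=E_{14}$; and $Y_\delta=X_\delta^{t}$ (transpose) for each positive root $\delta$. Put $H_0=H_\alpha+2H_\beta+H_\gamma$. A unitary $(\mathfrak g,K)$-module $V$ is an admissible $(\mathfrak g,K)$-module with a positive-definite Hermitian inner product such that $(Xv,w)=-(v,Xw)$ for all $X\in\mathfrak g_0$, $v,w\in V$. A $K$-highest weight vector of weight $(n,k,m)$ ($n,m\in\mathbb Z_{\ge0}$, $k\in\mathbb Z$) is $v\in V$ with $X_\alpha v=X_\gamma v=0$, $H_\alpha v=nv$, $H_\gamma v=mv$, $H_0v=kv$. $V^+$ is the span of all such vectors. For $T:V^+\to V^+$, the adjoint $T^*:V^+\to V^+$ is the operator with $(Tv,w)=(v,T^*w)$ for all $v,w\in V^+$. Rational expressions in $H_\alpha,H_\gamma$ act on a highest weight vector of weight $(n,k,m)$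 as the scalar obtained by $H_\alpha\mapsto n$, $H_\gamma\mapsto m$; products are compositions, the rightmost factor acting first. The following operators map $V^+$ to itself: $A_{\alpha+\beta+\gamma}=X_{\alpha+\beta+\gamma}$; $A_{\alpha+\beta}=X_{\alpha+\beta}(H_\gamma+1)+Y_\gamma X_{\alpha+\beta+\gamma}$; $A_{\beta+\gamma}=X_{\beta+\gamma}(H_\alpha+1)-Y_\alpha X_{\alpha+\beta+\gamma}$; $A_\beta=X_\beta(H_\alpha+1)(H_\gamma+1)-Y_\alpha X_{\alpha+\beta}(H_\gamma+1)+Y_\gamma X_{\beta+\gamma}(H_\alpha+1)-Y_\alpha Y_\gamma X_{\alpha+\beta+\gamma}$; $B_{\alpha+\beta+\gamma}=Y_{\alpha+\beta+\gamma}(H_\alpha+1)(H_\gamma+1)+Y_\alpha Y_{\beta+\gamma}(H_\gamma+1)-Y_\gamma Y_{\alpha+\beta}(H_\alpha+1)-Y_\alpha Y_\gamma Y_\beta$; $B_{\alpha+\beta}=Y_{\alpha+\beta}(H_\alpha+1)+Y_\alpha Y_\beta$; $B_{\beta+\gamma}=Y_{\beta+\gamma}(H_\gamma+1)-Y_\gamma Y_\beta$; $B_\beta=Y_\beta$. *)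

(* Defs.v *)
From HB Require Import structures.
From mathcomp Require Import all_boot all_order all_algebra.
From mathcomp Require Import sesquilinear spectral.
From mathcomp Require Import all_classical all_reals all_analysis.
From mathcomp Require Import complex.

Set Implicit Arguments.
Unset Strict Implicit.
Unset Printing Implicit Defensive.

Import Order.TTheory GRing.Theory Num.Theory numFieldNormedType.Exports.

Local Open Scope classical_set_scope.
Local Open Scope ring_scope.
Local Open Scope complex_scope.
Local Open Scope sesquilinear_scope.

(* MathComp-Analysis over C = R[i], for an arbitrary realType R. The usual
   topology of C (given by the modulus) is not declared on R[i] by the library;
   it induces the entrywise topology on matrices. *)
HB.instance Definition _ (R : realType) := PseudoPointedMetric.copy R[i] R[i]^o.

Section LieData.
Variable R : realType.
Local Notation C := R[i].

(* Matrix units are numbered from 1: E i j is meant for 1 <= i, j <= 4. *)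
Definition E (i j : nat) : 'M[C]_4 := delta_mx (inord i.-1) (inord j.-1).

Definition H_a : 'M[C]_4 := E 1 1 - E 2 2.
Definition H_b : 'M[C]_4 := E 2 2 - E 3 3.
Definition H_g : 'M[C]_4 := E 3 3 - E 4 4.
Definition H_0 : 'M[C]_4 := H_a + 2 *: H_b + H_g.

Definition X_a : 'M[C]_4 := E 1 2.
Definition X_b : 'M[C]_4 := E 2 3.
Definition X_g : 'M[C]_4 := E 3 4.
Definition X_ab : 'M[C]_4 := E 1 3.
Definition X_bg : 'M[C]_4 := E 2 4.
Definition X_abg : 'M[C]_4 := E 1 4.

Definition Y_a : 'M[C]_4 := X_a^T.
Definition Y_b : 'M[C]_4 := X_b^T.
Definition Y_g : 'M[C]_4 := X_g^T.
Definition Y_ab : 'M[C]_4 := X_ab^T.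
Definition Y_bg : 'M[C]_4 := X_bg^T.
Definition Y_abg : 'M[C]_4 := X_abg^T.

Definition sl4 : set 'M[C]_4 := [set X | \tr X = 0].

Definition J : 'M[C]_4 := diag_mx (\row_j (if (j < 2)%N then 1 else -1)).

Definition su22 : set 'M[C]_4 :=
  [set X | \tr X = 0 /\ X^t* *m J + J *m X = 0].

Definition block_diagonal (X : 'M[C]_4) : Prop :=
  forall i j : 'I_4, (i < 2)%N != (j < 2)%N -> X i j = 0.

(* K = S(U(2) x U(2)) *)
Definition K : set 'M[C]_4 :=
  [set g | [/\ block_diagonal g, g \is unitarymx & \det g = 1]].

(* the Lie algebra of K *)
Definition lieK : set 'M[C]_4 := [set X | su22 X /\ block_diagonal X].

Definition expmx (X : 'M[C]_4) : 'M[C]_4 :=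
  lim (series (fun n : nat => n`!%:R^-1 *: X ^+ n) @ \oo).

End LieData.

Section GKModules.
Variable R : realType.
Local Notation C := R[i].

(* Actions are functions of all 4 x 4 matrices; only their values on K,
   respectively on sl(4, C), are constrained or used.

   Continuity and derivatives of orbit maps g |-> g v are tested against all
   linear functionals of V. Every v below lies in a finite-dimensional K-stable
   subspace, and functionals on it extend to V, so this is continuity and
   differentiability for the usual topology of that subspace. *)

Record K_module (V : lmodType C) (kact : 'M[C]_4 -> {linear V -> V}) : Prop := {
  kact1 : forall v, kact 1%:M v = v;
  kactM : forall g h v, K g -> K h -> kact (g *m h) v = kact g (kact h v);
  kact_continuous : forall (l : {scalar V}) (v : V),
    {within @K R, continuous (fun g => l (kact g v))};
  kact_finite : forall v, exists (N : nat) (e : 'I_N -> V),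
    forall g, K g -> exists c : 'I_N -> C, kact g v = \sum_i c i *: e i
}.

Record gK_module (V : lmodType C) (act kact : 'M[C]_4 -> {linear V -> V})
    : Prop := {
  act_linear : forall (c : C) X Y v, sl4 X -> sl4 Y ->
    act (c *: X + Y) v = c *: act X v + act Y v;
  act_bracket : forall X Y v, sl4 X -> sl4 Y ->
    act (X *m Y - Y *m X) v = act X (act Y v) - act Y (act X v);
  gK_K_module : K_module kact;
  kact_Ad : forall g X v, K g -> sl4 X ->
    kact g (act X v) = act (g *m X *m invmx g) (kact g v);
  kact_differential : forall X (l : {scalar V}) (v : V), lieK X ->
    (h%:C)^-1 * (l (kact (expmx (h%:C *: X)) v) - l v)
      @[h --> (0 : R)^'] --> l (act X v)
}.

Definition irreducible_K_module (W : vectType C)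
    (sigma : 'M[C]_4 -> {linear W -> W}) : Prop :=
  [/\ K_module sigma,
      {:W}%VS <> 0%VS
    & forall U : {vspace W},
        (forall g w, K g -> w \in U -> sigma g w \in U) ->
        U = 0%VS \/ U = {:W}%VS].

Definition K_equivariant (W V : lmodType C)
    (sigma : 'M[C]_4 -> {linear W -> W}) (kact : 'M[C]_4 -> {linear V -> V})
    (f : {linear W -> V}) : Prop :=
  forall g w, K g -> f (sigma g w) = kact g (f w).

(* every K-type has finite multiplicity: dim Hom_K(W, V) < oo *)
Definition admissible (V : lmodType C) (kact : 'M[C]_4 -> {linear V -> V})
    : Prop :=
  forall (W : vectType C) (sigma : 'M[C]_4 -> {linear W -> W}),
    irreducible_K_module sigma ->
    exists (N : nat) (e : 'I_N -> {linear W -> V}),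
      (forall i, K_equivariant sigma kact (e i)) /\
      forall f : {linear W -> V}, K_equivariant sigma kact f ->
        exists c : 'I_N -> C, forall w, f w = \sum_i c i *: e i w.

(* The inner product is linear in its first argument and conjugate-linear in
   its second. *)
Record unitary_gK_module (V : lmodType C)
    (act kact : 'M[C]_4 -> {linear V -> V})
    (form : {dot V for (@Num.conj C)}) : Prop := {
  unitary_gK : gK_module act kact;
  unitary_admissible : admissible kact;
  unitary_invariant : forall X v w, su22 X ->
    form (act X v) w = - form v (act X w)
}.

End GKModules.

Section HighestWeight.
Variables (R : realType) (V : lmodType R[i]).
Local Notation C := R[i].
Variable act : 'M[C]_4 -> {linear V -> V}.

(* v = 0 is allowed, which does not affect spans. *)
Definition K_highest_weight (n : nat) (k : int) (m : nat) (v : V) : Prop :=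
  [/\ act (X_a R) v = 0, act (X_g R) v = 0
    & [/\ act (H_a R) v = n%:R *: v, act (H_g R) v = m%:R *: v
        & act (H_0 R) v = k%:~R *: v]].

Definition Vplus : set V :=
  [set v | exists (N : nat) (c : 'I_N -> C) (w : 'I_N -> V),
    (forall i, exists n k m, K_highest_weight n k m (w i)) /\
    v = \sum_i c i *: w i].

(* hact f is the action on Vplus of the rational expression f(H_a, H_g):
   multiplication by f(n, m) on highest weight vectors of weight (n, k, m),
   extended linearly. The value chosen by xget is unique on Vplus, since vectors
   of distinct weights are independent; off Vplus, hact f is 0. *)
Definition hact (f : C -> C -> C) (v : V) : V :=
  xget 0 [set u | exists (N : nat) (n : 'I_N -> nat) (k : 'I_N -> int)
      (m : 'I_N -> nat) (w : 'I_N -> V),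
    [/\ forall i, K_highest_weight (n i) (k i) (m i) (w i),
        v = \sum_i w i
      & u = \sum_i f (n i)%:R (m i)%:R *: w i]].

(* In the arguments of hact, a and c stand for H_a and H_g. *)
Definition A_abg (v : V) : V := act (X_abg R) v.

Definition A_ab (v : V) : V :=
  act (X_ab R) (hact (fun a c => c + 1) v) + act (Y_g R) (act (X_abg R) v).

Definition A_bg (v : V) : V :=
  act (X_bg R) (hact (fun a c => a + 1) v) - act (Y_a R) (act (X_abg R) v).

Definition A_b (v : V) : V :=
  act (X_b R) (hact (fun a c => (a + 1) * (c + 1)) v)
  - act (Y_a R) (act (X_ab R) (hact (fun a c => c + 1) v))
  + act (Y_g R) (act (X_bg R) (hact (fun a c => a + 1) v))
  - act (Y_a R) (act (Y_g R) (act (X_abg R) v)).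

Definition B_abg (v : V) : V :=
  act (Y_abg R) (hact (fun a c => (a + 1) * (c + 1)) v)
  + act (Y_a R) (act (Y_bg R) (hact (fun a c => c + 1) v))
  - act (Y_g R) (act (Y_ab R) (hact (fun a c => a + 1) v))
  - act (Y_a R) (act (Y_g R) (act (Y_b R) v)).

Definition B_ab (v : V) : V :=
  act (Y_ab R) (hact (fun a c => a + 1) v) + act (Y_a R) (act (Y_b R) v).

Definition B_bg (v : V) : V :=
  act (Y_bg R) (hact (fun a c => c + 1) v) - act (Y_g R) (act (Y_b R) v).

Definition B_b (v : V) : V := act (Y_b R) v.

Definition maps_Vplus (T : V -> V) : Prop :=
  forall v, Vplus v -> Vplus (T v).

(* S is the adjoint T^* of T for the restriction of form to Vplus, T and S
   being given by functions on V of which only the restrictions to Vplus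
   matter; such an S is unique on Vplus since form is positive definite. *)
Definition adjoint_on_Vplus (form : {dot V for (@Num.conj C)})
    (T S : V -> V) : Prop :=
  [/\ maps_Vplus T, maps_Vplus S
    & forall v w, Vplus v -> Vplus w -> form (T v) w = form v (S w)].

End HighestWeight.

(* Main.v *)
Require Import Defs.
From mathcomp Require Import all_boot all_order all_algebra.
From mathcomp Require Import sesquilinear all_classical all_reals all_analysis.
From mathcomp Require Import complex.
From mathcomp Require Import spectral ring zify.
Import Order.TTheory GRing.Theory Num.Theory.
Local Open Scope ring_scope.
Local Open Scope complex_scope.

(** Write tau X = J X^* J for the conjugate-linear map that is -1 on su(2,2).
    Splitting X as (P - iQ)/2 with P = X - tau X and Q = i(X + tau X), both in
    su(2,2), turns the invariance of the inner product into
    (X v, w) = (v, tau(X) w) for every X in sl(4, C) ([form_adjoint]). Thus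
    E_ij^* = E_ji for a compact root, E_ij^* = - E_ji for a noncompact one, and
    the diagonal elements are self-adjoint; so weight vectors of distinct
    weights are orthogonal, and an operator that is a rational expression in
    H_alpha, H_gamma is well defined on V^+ ([hact_sum]).

    Let T be one of the eight operators, A_delta or B_delta, and X = X_delta or
    X = Y_delta its leading root vector. On a highest weight vector v of weight
    (n, k, m), T v is again a highest weight vector, of shifted weight, and
      T v = f(n, m) X v + Y_alpha u1 + Y_gamma u2
    for a scalar f(n, m) and some u1, u2 ([shift_operator]). If w is killed by
    X_alpha and X_gamma, then (Y_alpha u1, w) = (u1, X_alpha w) = 0, and likewise
    for Y_gamma, so that (T v, w) = f(n, m) (X v, w) = - f(n, m) (v, X^t w). The
    operator S belonging to X^t satisfies (v, S w) = g(n', m') (v, X^t w) when w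
    has weight (n', k', m'). Both sides vanish unless the weight of w is the
    shifted weight of v; hence T^* = - S h as soon as
    h(n', m') g(n', m') = f(n, m) for those pairs of weights, which is a scalar
    identity ([shift_adjoint]).

    That T v is a highest weight vector is a computation with commutators. When
    n or m is 0, a shifted weight may be negative; then the shifted vector is 0,
    because X_alpha u = 0 and H_alpha u = p u imply
    |Y_alpha u|^2 = p |u|^2 ([negative_weight_eq0]). *)

Set Implicit Arguments.
Unset Strict Implicit.
Unset Printing Implicit Defensive.
Local Open Scope sesquilinear_scope.

(** * Matrix units and the conjugation defining su(2,2) *)

Lemma subrBACB (Z : zmodType) (a b c d : Z) :
  a - b - (c - d) = a - c - (b - d).
Proof. by rewrite !opprB addrACA [RHS]addrACA [- b - c]addrC. Qed.

Section Matrices.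
Variable R : realType.
Local Notation C := R[i].

Lemma mul_E_E i j k l : (0 < j <= 4)%N -> (0 < k <= 4)%N ->
  E R i j *m E R k l = (j == k)%:R *: E R i l.
Proof.
move=> /andP[j0 j4] /andP[k0 k4].
rewrite /E mul_delta_mx_cond scaler_nat -val_eqE /= !inordK; try lia.
by case: j k j0 j4 k0 k4 => [|j] [|k] //= _ _ _ _.
Qed.

Lemma tr_E (i j : nat) : E R i j = (E R j i)^T.
Proof. by rewrite trmx_delta. Qed.

Lemma sl4_E i j : (0 < i <= 4)%N -> (0 < j <= 4)%N -> i != j -> sl4 (E R i j).
Proof.
move=> i4 j4 ij; rewrite /sl4 /= /mxtrace big1 // => k _; rewrite mxE.
case: eqP => // ->; case: eqP => // /(congr1 val) /=; rewrite !inordK; lia.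
Qed.

Lemma sl4_diagB i j : sl4 (E R i i - E R j j).
Proof.
rewrite /sl4 /= raddfB /= /E; have tr1 k : \tr (delta_mx k k : 'M[C]_4) = 1.
  rewrite /mxtrace (bigD1 k) //= big1 ?addr0 => [|l lk]; rewrite mxE ?eqxx //.
  by rewrite (negPf lk).
by rewrite !tr1 subrr.
Qed.

Lemma J_sqr : J R *m J R = 1%:M.
Proof.
rewrite /J mulmx_diag -[RHS]diag_const_mx; congr diag_mx.
by apply/rowP => j; rewrite !mxE; case: ifP => _; ring.
Qed.

Lemma J_adj : (J R)^t* = J R.
Proof.
apply/matrixP => i j; rewrite !mxE eq_sym.
case: eqP => [->|_]; last by rewrite !mulr0n rmorph0.
by rewrite !mulr1n; case: ifP => _; rewrite ?rmorphN rmorph1.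
Qed.

(** The conjugate-linear map X |-> J X^* J, where X^* is the conjugate transpose:
    a matrix of sl(4, C) is in su(2,2) if and only if tau X = - X. *)
Definition tau (X : 'M[C]_4) : 'M[C]_4 := J R *m X^t* *m J R.

Lemma tr_tau X : \tr (tau X) = (\tr X)^*%R.
Proof.
rewrite /tau mxtrace_mulC mulmxA J_sqr mul1mx -map_trmx mxtrace_tr /mxtrace.
by rewrite raddf_sum; apply: eq_bigr => i _ /=; rewrite !mxE.
Qed.

Lemma adjmxZ (c : C) (X : 'M[C]_4) : (c *: X)^t* = c^*%R *: X^t*.
Proof. by apply/matrixP => i j; rewrite !mxE rmorphM. Qed.

Lemma adjmxD (X Y : 'M[C]_4) : (X + Y)^t* = X^t* + Y^t*.
Proof. by rewrite linearD map_mxD. Qed.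

Lemma adjmxB (X Y : 'M[C]_4) : (X - Y)^t* = X^t* - Y^t*.
Proof. by rewrite linearB map_mxB. Qed.

Lemma adjmxM (X Y : 'M[C]_4) : (X *m Y)^t* = Y^t* *m X^t*.
Proof. by rewrite trmx_mul map_mxM. Qed.

Lemma su22_B X : sl4 X -> su22 (X - tau X).
Proof.
rewrite /sl4 /su22 /= => trX; split.
  by rewrite linearB /= tr_tau trX rmorph0 subrr.
rewrite adjmxB /tau !adjmxM J_adj trmxCK mulmxBl mulmxBr.
rewrite !mulmxA J_sqr mul1mx -!mulmxA J_sqr mulmx1.
by rewrite addrC addrA subrK subrr.
Qed.

Lemma su22_iD X : sl4 X -> su22 ('i *: (X + tau X)).
Proof.
rewrite /sl4 /su22 /= => trX; split.
  by rewrite linearZ linearD /= tr_tau trX rmorph0 addr0 mulr0.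
rewrite adjmxZ conjCi adjmxD /tau !adjmxM J_adj trmxCK -scalemxAl -scalemxAr.
rewrite mulmxDl mulmxDr.
rewrite !mulmxA J_sqr mul1mx -!mulmxA J_sqr mulmx1.
by rewrite scaleNr (addrC (J R *m X)) addNr.
Qed.

Lemma tauB X Y : tau (X - Y) = tau X - tau Y.
Proof. by rewrite /tau adjmxB mulmxBr mulmxBl. Qed.

(** The sign is -1 exactly when i and j lie in different diagonal blocks, that is,
    when E_ij is a noncompact root vector. *)
Lemma tauE i j : (0 < i <= 4)%N -> (0 < j <= 4)%N ->
  tau (E R i j) = (-1) ^+ ((i <= 2) != (j <= 2))%N *: E R j i.
Proof.
move=> i4 j4; rewrite /tau tr_E trmxK map_delta_mx /J.
apply/matrixP => k l; rewrite mul_diag_mx mul_mx_diag !mxE.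
case: eqP => [->|_] /=; last by rewrite mulr0 mul0r mulr0.
case: eqP => [->|_] /=; last by rewrite mulr0 mul0r mulr0.
rewrite !inordK; try lia.
have -> : (j.-1 < 2)%N = (j <= 2)%N by lia.
have -> : (i.-1 < 2)%N = (i <= 2)%N by lia.
by case: (_ <= 2)%N; case: (_ <= 2)%N => /=; ring.
Qed.

Lemma sl4_0 : sl4 (0 : 'M[C]_4).
Proof. by rewrite /sl4 /= mxtrace0. Qed.

Lemma sl4D (X Y : 'M[C]_4) : sl4 X -> sl4 Y -> sl4 (X + Y).
Proof. by rewrite /sl4 /= linearD /= => -> ->; rewrite addr0. Qed.

Lemma sl4Z c (X : 'M[C]_4) : sl4 X -> sl4 (c *: X).
Proof. by rewrite /sl4 /= linearZ /= => ->; rewrite mulr0. Qed.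

Lemma sl4_tau (X : 'M[C]_4) : sl4 X -> sl4 (tau X).
Proof. by rewrite /sl4 /= tr_tau => ->; rewrite rmorph0. Qed.

Lemma su22_sl4 (X : 'M[C]_4) : su22 X -> sl4 X.
Proof. by case. Qed.

(** The coefficient of e_a in the root e_i - e_j of E_ij. *)
Definition root_coord (a i j : nat) : int := (a == i)%:Z - (a == j)%:Z.

Lemma bracket_diag_E a i j :
  (0 < a <= 4)%N -> (0 < i <= 4)%N -> (0 < j <= 4)%N ->
  E R a a *m E R i j - E R i j *m E R a a = (root_coord a i j)%:~R *: E R i j.
Proof.
move=> a4 i4 j4; rewrite !mul_E_E // /root_coord rmorphB scalerBl /=.
congr (_ - _).
  by case: eqP => [->|]; rewrite ?scale1r ?scale0r.
by rewrite eq_sym; case: eqP => [->|]; rewrite ?scale1r ?scale0r.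
Qed.

Lemma bracket_diagB_E a b i j : (0 < a <= 4)%N -> (0 < b <= 4)%N ->
  (0 < i <= 4)%N -> (0 < j <= 4)%N ->
  (E R a a - E R b b) *m E R i j - E R i j *m (E R a a - E R b b) =
    (root_coord a i j - root_coord b i j)%:~R *: E R i j.
Proof.
move=> a4 b4 i4 j4; rewrite rmorphB scalerBl -!bracket_diag_E //.
rewrite mulmxBl mulmxBr.
exact: subrBACB.
Qed.

Lemma H_0E : H_0 R = (E R 1 1 - E R 3 3) + (E R 2 2 - E R 4 4).
Proof.
rewrite /H_0 /H_a /H_b /H_g; apply/matrixP => k l; rewrite !mxE; ring.
Qed.

Lemma sl4_H_0 : sl4 (H_0 R).
Proof. by rewrite H_0E; apply: sl4D; exact: sl4_diagB. Qed.

End Matrices.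

Section UnitaryModule.
Variables (R : realType) (V : lmodType R[i]).
Local Notation C := R[i].
Variables (act kact : 'M[C]_4 -> {linear V -> V}).
Variable form : {dot V for (@Num.conj C)}.
Hypothesis unitaryV : unitary_gK_module act kact form.

Let gKV := unitary_gK unitaryV.

(** * Adjoints of the Lie algebra action *)

Lemma act0 v : act 0 v = 0.
Proof.
have := act_linear gKV 1 v (sl4_0 R) (sl4_0 R).
by rewrite !scale1r addr0 => /eqP; rewrite eq_sym -subr_eq0 addrK => /eqP.
Qed.

Lemma actZ c X v : sl4 X -> act (c *: X) v = c *: act X v.
Proof.
by move=> sX; rewrite -[c *: X]addr0 (act_linear gKV _ _ sX (sl4_0 R)) act0 addr0.
Qed.

Lemma actD X Y v : sl4 X -> sl4 Y -> act (X + Y) v = act X v + act Y v.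
Proof.
by move=> sX sY; rewrite -[X]scale1r (act_linear gKV _ _ sX sY) !scale1r.
Qed.

Lemma form_conj v w : form v w = (form w v)^*%R.
Proof. by rewrite (hermC form) expr0 mul1r. Qed.

(** Used for [c] the imaginary unit, of which only [c^* = - c] matters. *)
Lemma form_adjoint_pair c P Q v w : c^*%R = - c -> su22 P -> su22 Q ->
  form (act (P + (- c) *: Q) v) w = - form v (act (P + c *: Q) w).
Proof.
move=> cN uP uQ; have sP := su22_sl4 uP; have sQ := su22_sl4 uQ.
have actPQ a u : act (P + a *: Q) u = act P u + a *: act Q u.
  by rewrite (actD u sP (sl4Z a sQ)) (actZ a u sQ).
rewrite !actPQ.
rewrite linearDl linearZl_LR linearDr linearZr_LR /= cN.
rewrite (unitary_invariant unitaryV _ _ uP) (unitary_invariant unitaryV _ _ uQ).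
by rewrite mulrNN mulNr opprD opprK.
Qed.

(** The adjoint of X in sl(4, C) acts as tau X. *)
Lemma form_adjoint X v w : sl4 X -> form (act X v) w = form v (act (tau X) w).
Proof.
move=> sX; have sX' := sl4_tau sX.
(* 2 X = P - iQ and -2 tau X = P + iQ for P = X - tau X, Q = i(X + tau X) *)
have := form_adjoint_pair v w (conjCi _) (su22_B sX) (su22_iD sX).
have -> : X - tau X + (- 'i) *: ('i *: (X + tau X)) = 2 *: X.
  rewrite scalerA mulNr -expr2 sqrCi opprK scale1r addrACA addNr addr0.
  by rewrite (scaler_nat 2 X) mulr2n.
have -> : X - tau X + 'i *: ('i *: (X + tau X)) = (- 2) *: tau X.
  rewrite scalerA -expr2 sqrCi scaleN1r opprD addrACA subrr add0r.
  by rewrite scaleNr (scaler_nat 2 (tau X)) mulr2n opprD.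
rewrite (actZ _ _ sX) (actZ _ _ sX') linearZl_LR linearZr_LR /=.
rewrite rmorphN rmorph_nat mulNr opprK.
by apply: mulfI; rewrite pnatr_eq0.
Qed.

Lemma form_E i j v w : (0 < i <= 4)%N -> (0 < j <= 4)%N -> i != j ->
  form (act (E R i j) v) w =
  (-1) ^+ ((i <= 2) != (j <= 2))%N * form v (act (E R j i) w).
Proof.
move=> i4 j4 ij; rewrite form_adjoint ?tauE //; last exact: sl4_E.
rewrite actZ; last by apply: sl4_E => //; rewrite eq_sym.
by rewrite linearZr_LR /= rmorphXn rmorphN rmorph1.
Qed.

Lemma form_noncompact i j v w :
  (0 < i <= 4)%N -> (0 < j <= 4)%N -> i != j -> (i <= 2)%N != (j <= 2)%N ->
  form (act (E R i j) v) w = - form v (act (E R j i) w).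
Proof. by move=> i4 j4 ij nc; rewrite form_E // nc expr1 mulN1r. Qed.

Lemma form_diagB i j v w : (0 < i <= 4)%N -> (0 < j <= 4)%N ->
  form (act (E R i i - E R j j) v) w = form v (act (E R i i - E R j j) w).
Proof.
move=> i4 j4; rewrite form_adjoint ?tauB ?tauE ?eqxx ?scale1r //.
exact: sl4_diagB.
Qed.

Lemma act_comm X Y v : sl4 X -> sl4 Y ->
  act X (act Y v) = act Y (act X v) + act (X *m Y - Y *m X) v.
Proof. by move=> sX sY; rewrite (act_bracket gKV) // addrC subrK. Qed.

Lemma act_commE i j k l v : (0 < i <= 4)%N -> (0 < j <= 4)%N -> i != j ->
   (0 < k <= 4)%N -> (0 < l <= 4)%N -> k != l ->
  act (E R i j) (act (E R k l) v) = act (E R k l) (act (E R i j) v) +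
    act ((j == k)%:R *: E R i l - (l == i)%:R *: E R k j) v.
Proof.
by move=> i4 j4 ij k4 l4 kl; rewrite act_comm ?mul_E_E //; apply: sl4_E.
Qed.

(** * Weights *)

(** [v] is an eigenvector of [X], or 0, with the integer eigenvalue [p]. *)
Definition has_weight (X : 'M[C]_4) (p : int) (v : V) := act X v = p%:~R *: v.

Lemma has_weightD X p v w :
  has_weight X p v -> has_weight X p w -> has_weight X p (v + w).
Proof. by rewrite /has_weight linearD scalerDr => -> ->. Qed.
Lemma has_weightZ X p c v : has_weight X p v -> has_weight X p (c *: v).
Proof. by rewrite /has_weight linearZ => -> /=; rewrite !scalerA mulrC. Qed.
Lemma has_weightN X p v : has_weight X p v -> has_weight X p (- v).
Proof. by rewrite -scaleN1r; apply: has_weightZ. Qed.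

Lemma has_weight_act H X p q v :
  sl4 H -> sl4 X -> H *m X - X *m H = q%:~R *: X ->
  has_weight H p v -> has_weight H (p + q) (act X v).
Proof.
move=> sH sX HX hv; rewrite /has_weight act_comm // HX actZ // hv.
by rewrite linearZ /= -scalerDl rmorphD.
Qed.

Lemma has_weight_E a b i j p v : (0 < a <= 4)%N -> (0 < b <= 4)%N ->
  (0 < i <= 4)%N -> (0 < j <= 4)%N -> i != j ->
  has_weight (E R a a - E R b b) p v ->
  has_weight (E R a a - E R b b) (p + (root_coord a i j - root_coord b i j))
    (act (E R i j) v).
Proof.
move=> a4 b4 i4 j4 ij; apply: has_weight_act.
- exact: sl4_diagB.
- exact: sl4_E.
- exact: bracket_diagB_E.
Qed.

(** E_aa - E_bb is self-adjoint, and p and q are real. *)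
Lemma has_weight_ortho a b p q v w : (0 < a <= 4)%N -> (0 < b <= 4)%N ->
   has_weight (E R a a - E R b b) p v -> has_weight (E R a a - E R b b) q w ->
  p != q -> form v w = 0.
Proof.
move=> a4 b4 hv hw pq; have := form_diagB v w a4 b4.
rewrite hv hw linearZl_LR linearZr_LR /= rmorph_int => /eqP.
rewrite -subr_eq0 -mulrBl -rmorphB mulf_eq0 intr_eq0 subr_eq0 (negPf pq).
by move=> /eqP.
Qed.

(** The hypothesis on [i] and [j] says that E_ij is a compact root vector, so that
    E_ji is its adjoint and |E_ji u|^2 = p |u|^2. *)
Lemma negative_weight_eq0 i j p u :
  (0 < i <= 4)%N -> (0 < j <= 4)%N -> i != j -> (i <= 2)%N = (j <= 2)%N ->
  act (E R i j) u = 0 -> has_weight (E R i i - E R j j) p u -> p < 0 -> u = 0.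
Proof.
move=> i4 j4 ij cpt Xu wu p0; have ji : j != i by rewrite eq_sym.
have := dnorm_ge0 form (act (E R j i) u).
rewrite form_E // cpt eqxx expr0 mul1r.
rewrite act_commE // !eqxx !scale1r Xu linear0 add0r.
rewrite wu linearZr_LR /= rmorph_int nmulr_rge0 ?ltrz0 // => u0.
apply/eqP; rewrite -(dnorm_eq0 form); apply/eqP/le_anti.
by rewrite u0 dnorm_ge0.
Qed.

Lemma has_weight_H_0 i j r v : (0 < i <= 4)%N -> (0 < j <= 4)%N -> i != j ->
  has_weight (H_0 R) r v ->
  has_weight (H_0 R) (r + ((root_coord 1 i j - root_coord 3 i j)
                           + (root_coord 2 i j - root_coord 4 i j)))
    (act (E R i j) v).
Proof.
move=> i4 j4 ij.
apply: has_weight_act; [exact: sl4_H_0|exact: sl4_E|].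
rewrite H_0E mulmxDl mulmxDr opprD addrACA !bracket_diagB_E //.
by rewrite -scalerDl -rmorphD.
Qed.

(** Weight vectors, or 0, for H_alpha, H_0, H_gamma with arbitrary integer
    eigenvalues [p], [r], [q]. *)
Definition K_weight (p r q : int) (v : V) :=
  [/\ has_weight (H_a R) p v, has_weight (H_0 R) r v & has_weight (H_g R) q v].

Lemma K_weightD p r q v w :
  K_weight p r q v -> K_weight p r q w -> K_weight p r q (v + w).
Proof. by case=> ? ? ? [? ? ?]; split; exact: has_weightD. Qed.
Lemma K_weightN p r q v : K_weight p r q v -> K_weight p r q (- v).
Proof. by case=> ? ? ?; split; exact: has_weightN. Qed.
Lemma K_weightZ p r q c v : K_weight p r q v -> K_weight p r q (c *: v).
Proof. by case=> ? ? ?; split; exact: has_weightZ. Qed.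

Lemma K_weight_E i j p r q p' r' q' v :
  (0 < i <= 4)%N -> (0 < j <= 4)%N -> i != j ->
  K_weight p r q v ->
  p' = p + (root_coord 1 i j - root_coord 2 i j) ->
  r' = r + ((root_coord 1 i j - root_coord 3 i j)
            + (root_coord 2 i j - root_coord 4 i j)) ->
  q' = q + (root_coord 3 i j - root_coord 4 i j) ->
  K_weight p' r' q' (act (E R i j) v).
Proof.
move=> i4 j4 ij [wp wr wq] -> -> ->; split.
- exact: has_weight_E.
- exact: has_weight_H_0.
- exact: has_weight_E.
Qed.

(** * Highest weight vectors and V^+ *)

Local Notation hw := (K_highest_weight act).

(** Highest weight vectors of a weight that is not assumed dominant: [p] and [q]
    may be negative here, which by [negative_weight_eq0] forces [v = 0]. *)
Definition K_highest p r q v :=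
  [/\ act (X_a R) v = 0, act (X_g R) v = 0 & K_weight p r q v].

Lemma hw_K_highest n k m v : hw n k m v -> K_highest n k m v.
Proof. by case=> ? ? [? ? ?]. Qed.

Lemma K_highest_hw p r q v : K_highest p r q v -> exists n k m, hw n k m v.
Proof.
move=> [Xa Xg [wp wr wq]].
have [v0|v0] := eqVneq v 0.
  (* the zero vector is a highest weight vector of every weight *)
  exists 0%N, 0, 0%N; rewrite v0.
  by split; [exact: linear0|exact: linear0|split; rewrite linear0 scaler0].
case: p wp => p wp; last first.
  by case/eqP: v0; apply: (@negative_weight_eq0 1 2 _ v _ _ _ _ Xa wp).
case: q wq => q wq; last first.
  by case/eqP: v0; apply: (@negative_weight_eq0 3 4 _ v _ _ _ _ Xg wq).
by exists p, r, q; split.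
Qed.

Lemma hwZ n k m c v : hw n k m v -> hw n k m (c *: v).
Proof.
case=> Xa Xg [wa wg w0]; split; [|by rewrite linearZ Xg; exact: scaler0|].
  by rewrite linearZ /= Xa scaler0.
by split; rewrite linearZ /= ?wa ?wg ?w0 !scalerA mulrC.
Qed.

Lemma hw_ortho n k m n' k' m' v w : hw n k m v -> hw n' k' m' w ->
  (n, m) != (n', m') -> form v w = 0.
Proof.
case/hw_K_highest=> _ _ [wn _ wm] /hw_K_highest[_ _ [wn' _ wm']].
rewrite xpair_eqE negb_and => /orP[?|?].
  exact: (has_weight_ortho (a := 1) (b := 2) _ _ wn wn').
exact: (has_weight_ortho (a := 3) (b := 4) _ _ wm wm').
Qed.

Lemma Vplus_sum v : Vplus act v -> exists N (n : 'I_N -> nat) (k : 'I_N -> int)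
  (m : 'I_N -> nat) (w : 'I_N -> V),
  (forall i, hw (n i) (k i) (m i) (w i)) /\ v = \sum_i w i.
Proof.
case=> N [c [w [hww ->]]].
have /choice[n /choice[k /choice[m hwi]]] := hww.
exists N, n, k, m, (fun i => c i *: w i).
by split=> // i; apply: hwZ.
Qed.

Lemma hw_Vplus N (w : 'I_N -> V) :
  (forall i, exists n k m, hw n k m (w i)) -> Vplus act (\sum_i w i).
Proof.
move=> h; exists N, (fun=> 1), w; split=> //.
by apply: eq_bigr => i _; rewrite scale1r.
Qed.

(** Only the [w i] with the same n and m as [x] contribute, by orthogonality. *)
Lemma form_sum_scaled (f : C -> C -> C) N (n : 'I_N -> nat) k (m : 'I_N -> nat)
    (w : 'I_N -> V) n' k' m' x :
  (forall i, hw (n i) (k i) (m i) (w i)) -> hw n' k' m' x ->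
  form (\sum_i f (n i)%:R (m i)%:R *: w i) x =
    f n'%:R m'%:R * form (\sum_i w i) x.
Proof.
move=> hwi hx; rewrite !linear_sumlz mulr_sumr; apply: eq_bigr => i _.
rewrite linearZl_LR /=.
have [[-> ->]//|nm] := eqVneq (n i, m i) (n', m').
by rewrite (hw_ortho (hwi i) hx nm) !mulr0.
Qed.

(** The value does not depend on the decomposition into highest weight vectors:
    by [form_sum_scaled], the difference of two candidate values is orthogonal to
    all highest weight vectors, hence to itself. *)
Lemma hact_sum f N (n : 'I_N -> nat) k (m : 'I_N -> nat) (w : 'I_N -> V) :
  (forall i, hw (n i) (k i) (m i) (w i)) ->
  hact act f (\sum_i w i) = \sum_i f (n i)%:R (m i)%:R *: w i.
Proof.
move=> hwi; apply: xget_unique; first by exists N, n, k, m, w.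
move=> u [N' [n' [k' [m' [w' [hwi' e ->]]]]]].
set a := \sum_i _; set b := \sum_i _.
have orth x : (exists n k m, hw n k m x) -> form (a - b) x = 0.
  case=> l [r [t hx]]; rewrite linearBl /= /a /b.
  by rewrite (form_sum_scaled f hwi hx) (form_sum_scaled f hwi' hx) e subrr.
apply/eqP; rewrite -subr_eq0 -(dnorm_eq0 form); apply/eqP.
have a0 : form (a - b) a = 0.
  rewrite {2}/a linear_sumr big1 // => i _; apply: orth.
  by do 3 eexists; apply/hwZ/hwi'.
have b0 : form (a - b) b = 0.
  rewrite {2}/b linear_sumr big1 // => i _; apply: orth.
  by do 3 eexists; apply/hwZ/hwi.
by rewrite linearBr /= a0 b0 subrr.
Qed.

Lemma hact_hw f n k m v : hw n k m v -> hact act f v = f n%:R m%:R *: v.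
Proof.
move=> hv; have := @hact_sum f 1 (fun=> n) (fun=> k) (fun=> m) (fun=> v).
by rewrite !big_ord1; apply.
Qed.

(** T is additive on sums of highest weight vectors; every element of V^+ is such
    a sum, so that T is determined on V^+ by its values on highest weight
    vectors. *)
Definition additive_on_Vplus (T : V -> V) := forall N (w : 'I_N -> V),
  (forall i, exists n k m, hw n k m (w i)) -> T (\sum_i w i) = \sum_i T (w i).

Lemma additive_hact f : additive_on_Vplus (hact act f).
Proof.
move=> N w h; have /choice[n /choice[k /choice[m hwi]]] := h.
rewrite (hact_sum f hwi); apply: eq_bigr => i _.
by rewrite (hact_hw f (hwi i)).
Qed.

Lemma additive_id : additive_on_Vplus id.
Proof. by []. Qed.

Lemma additive_act X T :
  additive_on_Vplus T -> additive_on_Vplus (fun v => act X (T v)).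
Proof. by move=> TV N w h; rewrite TV // linear_sum. Qed.

Lemma additiveD S T :
  additive_on_Vplus S -> additive_on_Vplus T ->
  additive_on_Vplus (fun v => S v + T v).
Proof. by move=> SV TV N w h; rewrite SV // TV // big_split. Qed.

Lemma additiveB S T :
  additive_on_Vplus S -> additive_on_Vplus T ->
  additive_on_Vplus (fun v => S v - T v).
Proof. by move=> SV TV N w h; rewrite SV // TV // sumrB. Qed.

(** * Adjoints of shift operators *)

(** [T] shifts the weights of highest weight vectors by [(p, r, q)], like the
    matrix [X], and T v is f(n, m) X v modulo the images of Y_alpha and Y_gamma
    for [v] of weight (n, k, m). *)
Record shift_operator (T : V -> V) (X : 'M[C]_4) (f : C -> C -> C)
    (p r q : int) : Prop := {
  shift_additive : additive_on_Vplus T;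
  shift_hw : forall n k m v, hw n k m v ->
    K_highest (n%:Z + p) (k + r) (m%:Z + q) (T v);
  shift_lead : forall n k m v, hw n k m v -> exists u1 u2,
    T v = f n%:R m%:R *: act X v + act (Y_a R) u1 + act (Y_g R) u2;
  shift_wt : forall n k m v, hw n k m v ->
    K_weight (n%:Z + p) (k + r) (m%:Z + q) (act X v)
}.

Lemma form_Y_a u w : act (X_a R) w = 0 -> form (act (Y_a R) u) w = 0.
Proof.
by move=> Xw; rewrite /Y_a /X_a -tr_E form_E // -/(X_a R) Xw linear0r mulr0.
Qed.

Lemma form_Y_g u w : act (X_g R) w = 0 -> form (act (Y_g R) u) w = 0.
Proof.
by move=> Xw; rewrite /Y_g /X_g -tr_E form_E // -/(X_g R) Xw linear0r mulr0.
Qed.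

(** The pairing with a vector killed by X_alpha and X_gamma only sees the leading
    term of T v. *)
Lemma shift_form T X f p r q n k m v w :
  shift_operator T X f p r q -> hw n k m v ->
  act (X_a R) w = 0 -> act (X_g R) w = 0 ->
  form (T v) w = f n%:R m%:R * form (act X v) w.
Proof.
move=> hT hv wa wg; have [u1 [u2 ->]] := shift_lead hT hv.
by rewrite !linearDl linearZl_LR /= form_Y_a // form_Y_g // !addr0.
Qed.

Lemma shift_Vplus T X f p r q : shift_operator T X f p r q -> maps_Vplus act T.
Proof.
move=> hT v /Vplus_sum[N [n [k [m [w [hwi ->]]]]]].
rewrite (shift_additive hT) => [|i]; last by exists (n i), (k i), (m i).
by apply: hw_Vplus => i; apply: K_highest_hw (shift_hw hT (hwi i)).
Qed.

(** The last hypothesis concerns a vector of weight (n, k, m) and one of its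
    shifted weight, whose first and last entries are n' and m'. *)
Lemma shift_adjoint T S X X' f g h p r q p' r' q' :
  shift_operator T X f p r q -> shift_operator S X' g p' r' q' ->
  (forall v w, form (act X v) w = - form v (act X' w)) ->
  (forall n m : nat, (f n%:R m%:R)^*%R = f n%:R m%:R) ->
  (forall n m n' m' : nat, n'%:Z = n%:Z + p -> m'%:Z = m%:Z + q ->
     h n'%:R m'%:R * g n'%:R m'%:R = f n%:R m%:R) ->
  adjoint_on_Vplus act form T (fun v => - S (hact act h v)).
Proof.
move=> hT hS adjXX' freal hgf; split; first exact: shift_Vplus hT.
  move=> v /Vplus_sum[N [n [k [m [w [hwi ->]]]]]].
  rewrite (hact_sum h hwi) (shift_additive hS) => [|i]; last first.
    by exists (n i), (k i), (m i); apply: hwZ.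
  rewrite -sumrN; apply: hw_Vplus => i; rewrite -scaleN1r.
  have hwh := hwZ (h (n i)%:R (m i)%:R) (hwi i).
  have [a [b [c Hw]]] := K_highest_hw (shift_hw hS hwh).
  by exists a, b, c; apply: hwZ.
move=> v w /Vplus_sum[N [n [k [m [v' [hv ->]]]]]].
move=> /Vplus_sum[N' [n' [k' [m' [w' [hw' ->]]]]]].
rewrite (hact_sum h hw') (shift_additive hT) => [|i]; last first.
  by exists (n i), (k i), (m i).
rewrite (shift_additive hS) => [|i]; last first.
  by exists (n' i), (k' i), (m' i); apply: hwZ.
rewrite -sumrN !linear_sumlz; apply: eq_bigr => i _.
rewrite !linear_sumr; apply: eq_bigr => j _ /=.
have [wa wg [wn _ wm]] := hw_K_highest (hw' j); have [va vg _] := hv i.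
rewrite (shift_form hT (hv i)) // linearNr /=.
rewrite (form_conj (v' i)).
rewrite (shift_form hS (hwZ _ (hw' j))) //.
rewrite linearZ linearZl_LR /= mulrA !rmorphM /= -form_conj.
rewrite [_^*%R * (h _ _)^*%R]mulrC -rmorphM.
(* compare the terms (X v'_i, w'_j): they vanish unless the weights match *)
have -> : form (v' i) (act X' (w' j)) = - form (act X (v' i)) (w' j).
  by rewrite adjXX' opprK.
rewrite mulrN opprK.
have [wp _ wq] := shift_wt hT (hv i).
have [e|ne] := eqVneq (n' j)%:Z ((n i)%:Z + p); last first.
  rewrite eq_sym in ne.
  by rewrite (has_weight_ortho (a := 1) (b := 2) _ _ wp wn ne) // !mulr0.
have [e'|ne] := eqVneq (m' j)%:Z ((m i)%:Z + q); last first.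
  rewrite eq_sym in ne.
  by rewrite (has_weight_ortho (a := 3) (b := 4) _ _ wq wm ne) // !mulr0.
by rewrite (hgf _ _ _ _ e e') /= freal.
Qed.

(** * Commutators and weights of the root vectors *)

(** Testing against all vectors reduces identities in V to ring identities. *)
Lemma form_ext u v : (forall x, form u x = form v x) -> u = v.
Proof.
move=> e; apply/eqP; rewrite -subr_eq0 -(dnorm_eq0 form).
by rewrite linearBl /= e subrr.
Qed.

Lemma formD u v x : form (u + v) x = form u x + form v x.
Proof. exact: linearDl. Qed.
Lemma formN u x : form (- u) x = - form u x.
Proof. exact: linearNl. Qed.
Lemma formZ c u x : form (c *: u) x = c * form u x.
Proof. exact: linearZl_LR. Qed.
Lemma form0 x : form 0 x = 0.
Proof. exact: linear0l. Qed.

(** Moving E_ij past E_kl; the excluded case is that of opposite roots, where the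
    commutator is diagonal. *)
Lemma commute_E i j k l v : (0 < i <= 4)%N -> (0 < j <= 4)%N -> i != j ->
   (0 < k <= 4)%N -> (0 < l <= 4)%N -> k != l -> ~~ ((j == k) && (l == i)) ->
  act (E R i j) (act (E R k l) v) = act (E R k l) (act (E R i j) v) +
    (if j == k then act (E R i l) v
     else if l == i then - act (E R k j) v else 0).
Proof.
move=> i4 j4 ij k4 l4 kl jk; rewrite act_commE //; congr (_ + _).
have [jk'|jk'] := eqVneq j k; have [li|li] := eqVneq l i.
- by rewrite jk' li !eqxx in jk.
- by rewrite !scale1r !scale0r !subr0.
- have skj : sl4 (E R k j) by apply: sl4_E => //; rewrite eq_sym.
  by rewrite !scale0r !sub0r !scale1r -(scaleN1r (E _ _ _)) actZ // scaleN1r.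
- by rewrite !scale0r !subr0 act0.
Qed.

(* [unfold_root_vectors] writes all root vectors as matrix units, so that the
   rules for E_ij apply. *)
Ltac unfold_root_vectors :=
  rewrite ?/Y_a ?/Y_b ?/Y_g ?/Y_ab ?/Y_bg ?/Y_abg
    ?/X_a ?/X_b ?/X_g ?/X_ab ?/X_bg ?/X_abg -?tr_E.
Ltac solve_commutator :=
  unfold_root_vectors; rewrite commute_E //= ?addr0 //.

Lemma X_a_X_b v :
  act (X_a R) (act (X_b R) v) =
  act (X_b R) (act (X_a R) v) + act (X_ab R) v.
Proof. solve_commutator. Qed.
Lemma X_a_X_ab v :
  act (X_a R) (act (X_ab R) v) =
  act (X_ab R) (act (X_a R) v).
Proof. solve_commutator. Qed.
Lemma X_a_X_bg v :
  act (X_a R) (act (X_bg R) v) =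
  act (X_bg R) (act (X_a R) v) + act (X_abg R) v.
Proof. solve_commutator. Qed.
Lemma X_a_X_abg v :
  act (X_a R) (act (X_abg R) v) =
  act (X_abg R) (act (X_a R) v).
Proof. solve_commutator. Qed.
Lemma X_a_Y_b v :
  act (X_a R) (act (Y_b R) v) =
  act (Y_b R) (act (X_a R) v).
Proof. solve_commutator. Qed.
Lemma X_a_Y_g v :
  act (X_a R) (act (Y_g R) v) =
  act (Y_g R) (act (X_a R) v).
Proof. solve_commutator. Qed.
Lemma X_a_Y_ab v :
  act (X_a R) (act (Y_ab R) v) =
  act (Y_ab R) (act (X_a R) v) - act (Y_b R) v.
Proof. solve_commutator. Qed.
Lemma X_a_Y_bg v :
  act (X_a R) (act (Y_bg R) v) =
  act (Y_bg R) (act (X_a R) v).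
Proof. solve_commutator. Qed.
Lemma X_a_Y_abg v :
  act (X_a R) (act (Y_abg R) v) =
  act (Y_abg R) (act (X_a R) v) - act (Y_bg R) v.
Proof. solve_commutator. Qed.

Lemma X_g_X_b v :
  act (X_g R) (act (X_b R) v) =
  act (X_b R) (act (X_g R) v) - act (X_bg R) v.
Proof. solve_commutator. Qed.
Lemma X_g_X_ab v :
  act (X_g R) (act (X_ab R) v) =
  act (X_ab R) (act (X_g R) v) - act (X_abg R) v.
Proof. solve_commutator. Qed.
Lemma X_g_X_bg v :
  act (X_g R) (act (X_bg R) v) =
  act (X_bg R) (act (X_g R) v).
Proof. solve_commutator. Qed.
Lemma X_g_X_abg v :
  act (X_g R) (act (X_abg R) v) =
  act (X_abg R) (act (X_g R) v).
Proof. solve_commutator. Qed.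
Lemma X_g_Y_a v :
  act (X_g R) (act (Y_a R) v) =
  act (Y_a R) (act (X_g R) v).
Proof. solve_commutator. Qed.
Lemma X_g_Y_b v :
  act (X_g R) (act (Y_b R) v) =
  act (Y_b R) (act (X_g R) v).
Proof. solve_commutator. Qed.
Lemma X_g_Y_ab v :
  act (X_g R) (act (Y_ab R) v) =
  act (Y_ab R) (act (X_g R) v).
Proof. solve_commutator. Qed.
Lemma X_g_Y_bg v :
  act (X_g R) (act (Y_bg R) v) =
  act (Y_bg R) (act (X_g R) v) + act (Y_b R) v.
Proof. solve_commutator. Qed.
Lemma X_g_Y_abg v :
  act (X_g R) (act (Y_abg R) v) =
  act (Y_abg R) (act (X_g R) v) + act (Y_ab R) v.
Proof. solve_commutator. Qed.

(** Rules that move X_alpha and X_gamma to the right; Y_alpha after X_alpha and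
    Y_gamma after X_gamma are left to [X_a_Y_a] and [X_g_Y_g], which need the
    weight of the vector. *)
Definition root_commutators := (X_a_X_b, X_a_X_ab, X_a_X_bg, X_a_X_abg, X_a_Y_b,
  X_a_Y_g, X_a_Y_ab, X_a_Y_bg, X_a_Y_abg, X_g_X_b, X_g_X_ab, X_g_X_bg,
  X_g_X_abg, X_g_Y_a, X_g_Y_b, X_g_Y_ab, X_g_Y_bg, X_g_Y_abg).

Lemma X_a_Y_a p r q u : K_weight p r q u ->
  act (X_a R) (act (Y_a R) u) = act (Y_a R) (act (X_a R) u) + p%:~R *: u.
Proof.
case=> wp _ _; rewrite /Y_a /X_a -tr_E act_commE // !eqxx !scale1r.
by rewrite wp.
Qed.

Lemma X_g_Y_g p r q u : K_weight p r q u ->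
  act (X_g R) (act (Y_g R) u) = act (Y_g R) (act (X_g R) u) + q%:~R *: u.
Proof.
case=> _ _ wq; rewrite /Y_g /X_g -tr_E act_commE // !eqxx !scale1r.
by rewrite wq.
Qed.

Ltac solve_root_weight :=
  let wv := fresh in intro wv; unfold_root_vectors;
  apply: (K_weight_E _ _ _ wv) => //; rewrite /root_coord /=; lia.

Lemma K_weight_X_b p r q v : K_weight p r q v ->
  K_weight (p - 1) (r + 2) (q - 1) (act (X_b R) v).
Proof. solve_root_weight. Qed.
Lemma K_weight_X_ab p r q v : K_weight p r q v ->
  K_weight (p + 1) (r + 2) (q - 1) (act (X_ab R) v).
Proof. solve_root_weight. Qed.
Lemma K_weight_X_bg p r q v : K_weight p r q v ->
  K_weight (p - 1) (r + 2) (q + 1) (act (X_bg R) v).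
Proof. solve_root_weight. Qed.
Lemma K_weight_X_abg p r q v : K_weight p r q v ->
  K_weight (p + 1) (r + 2) (q + 1) (act (X_abg R) v).
Proof. solve_root_weight. Qed.
Lemma K_weight_Y_b p r q v : K_weight p r q v ->
  K_weight (p + 1) (r - 2) (q + 1) (act (Y_b R) v).
Proof. solve_root_weight. Qed.
Lemma K_weight_Y_ab p r q v : K_weight p r q v ->
  K_weight (p - 1) (r - 2) (q + 1) (act (Y_ab R) v).
Proof. solve_root_weight. Qed.
Lemma K_weight_Y_bg p r q v : K_weight p r q v ->
  K_weight (p + 1) (r - 2) (q - 1) (act (Y_bg R) v).
Proof. solve_root_weight. Qed.
Lemma K_weight_Y_abg p r q v : K_weight p r q v ->
  K_weight (p - 1) (r - 2) (q - 1) (act (Y_abg R) v).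
Proof. solve_root_weight. Qed.
Lemma K_weight_Y_a p r q v : K_weight p r q v ->
  K_weight (p - 2) r q (act (Y_a R) v).
Proof. solve_root_weight. Qed.
Lemma K_weight_Y_g p r q v : K_weight p r q v ->
  K_weight p r (q - 2) (act (Y_g R) v).
Proof. solve_root_weight. Qed.

(** * The eight operators *)

(* [push_linear] distributes the action over linear combinations, [module_ring]
   proves linear identities in V, [solve_additive] proves additivity of a
   combination of actions and of [hact], [solve_weights] computes the weight of a
   combination of products of root vectors applied to a weight vector, and
   [solve_highest] normalizes X_alpha or X_gamma applied to T v, given that both
   kill v. *)
Ltac push_linear := rewrite ?(linearD, linearB, linearN, linearZ, linear0) /=.
Ltac module_ring := apply: form_ext => x;
  rewrite ?(formD, formN, formZ, form0); ring.
(* A difference also matches the pattern of a sum, so it is tried first. *)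
Ltac solve_additive := repeat first [apply: additiveB | apply: additiveD
  | exact: additive_hact | exact: additive_id | apply: additive_act].

Lemma K_weight_eq p r q p' r' q' v :
  K_weight p r q v -> p = p' -> r = r' -> q = q' ->
  K_weight p' r' q' v.
Proof. by move=> ? <- <- <-. Qed.

Ltac root_weight_step := first [eassumption | lazymatch goal with
  |- K_weight _ _ _ (?f _) => lazymatch f with
    | context [X_b _] => eapply K_weight_X_b
    | context [Y_b _] => eapply K_weight_Y_b
    | context [X_ab _] => eapply K_weight_X_ab
    | context [Y_ab _] => eapply K_weight_Y_ab
    | context [X_bg _] => eapply K_weight_X_bg
    | context [Y_bg _] => eapply K_weight_Y_bg
    | context [X_abg _] => eapply K_weight_X_abg
    | context [Y_abg _] => eapply K_weight_Y_abg
    | context [Y_a _] => eapply K_weight_Y_a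
    | context [Y_g _] => eapply K_weight_Y_g
  end end].
Ltac solve_weight := eapply K_weight_eq; [repeat root_weight_step | lia ..].
Ltac solve_weights := push_linear;
  repeat first [apply: K_weightD | apply: K_weightN | apply: K_weightZ];
  solve_weight.
Ltac solve_highest va vg :=
  rewrite ?root_commutators ?va ?vg; push_linear; module_ring.

Lemma A_ab_shift :
  shift_operator (A_ab act) (X_ab R) (fun a c => c + 1) 1 2 (-1).
Proof.
rewrite /A_ab; split => [|n k m v hv|n k m v hv|n k m v hv].
- solve_additive.
- rewrite (hact_hw _ hv); have [va vg wv] := hw_K_highest hv.
  have w_abg := K_weight_X_abg wv; split.
  + push_linear; solve_highest va vg.
  + push_linear; rewrite (X_g_Y_g w_abg); solve_highest va vg.
  + solve_weights.
- rewrite (hact_hw _ hv).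
  exists 0, (act (X_abg R) v); push_linear; module_ring.
- have [_ _ wv] := hw_K_highest hv; solve_weights.
Qed.

Lemma A_abg_shift :
  shift_operator (A_abg act) (X_abg R) (fun a c => 1) 1 2 1.
Proof.
rewrite /A_abg; split => [|n k m v hv|n k m v hv|n k m v hv].
- solve_additive.
- have [va vg wv] := hw_K_highest hv; split.
  + solve_highest va vg.
  + solve_highest va vg.
  + solve_weights.
- exists 0, 0; push_linear; module_ring.
- have [_ _ wv] := hw_K_highest hv; solve_weights.
Qed.

Lemma A_bg_shift :
  shift_operator (A_bg act) (X_bg R) (fun a c => a + 1) (-1) 2 1.
Proof.
rewrite /A_bg; split => [|n k m v hv|n k m v hv|n k m v hv].
- solve_additive.
- rewrite (hact_hw _ hv); have [va vg wv] := hw_K_highest hv.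
  have w_abg := K_weight_X_abg wv; split.
  + push_linear; rewrite (X_a_Y_a w_abg); solve_highest va vg.
  + push_linear; solve_highest va vg.
  + solve_weights.
- rewrite (hact_hw _ hv).
  exists (- act (X_abg R) v), 0; push_linear; module_ring.
- have [_ _ wv] := hw_K_highest hv; solve_weights.
Qed.

Lemma A_b_shift :
  shift_operator (A_b act) (X_b R) (fun a c => (a + 1) * (c + 1)) (-1) 2 (-1).
Proof.
rewrite /A_b; split => [|n k m v hv|n k m v hv|n k m v hv].
- solve_additive.
- rewrite !(hact_hw _ hv); have [va vg wv] := hw_K_highest hv.
  have w_ab := K_weight_X_ab wv; have w_bg := K_weight_X_bg wv.
  have w_abg := K_weight_X_abg wv; have w_g := K_weight_Y_g w_abg; split.
  + push_linear; rewrite (X_a_Y_a w_ab) (X_a_Y_a w_g); solve_highest va vg.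
  + push_linear; rewrite !root_commutators (X_g_Y_g w_bg) (X_g_Y_g w_abg).
    by push_linear; solve_highest va vg.
  + solve_weights.
- rewrite !(hact_hw _ hv).
  exists (- ((m%:R + 1) *: act (X_ab R) v) - act (Y_g R) (act (X_abg R) v)).
  exists ((n%:R + 1) *: act (X_bg R) v); push_linear; module_ring.
- have [_ _ wv] := hw_K_highest hv; solve_weights.
Qed.

Lemma B_b_shift :
  shift_operator (B_b act) (Y_b R) (fun a c => 1) 1 (-2) 1.
Proof.
rewrite /B_b; split => [|n k m v hv|n k m v hv|n k m v hv].
- solve_additive.
- have [va vg wv] := hw_K_highest hv; split.
  + solve_highest va vg.
  + solve_highest va vg.
  + solve_weights.
- exists 0, 0; push_linear; module_ring.
- have [_ _ wv] := hw_K_highest hv; solve_weights.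
Qed.

Lemma B_ab_shift :
  shift_operator (B_ab act) (Y_ab R) (fun a c => a + 1) (-1) (-2) 1.
Proof.
rewrite /B_ab; split => [|n k m v hv|n k m v hv|n k m v hv].
- solve_additive.
- rewrite (hact_hw _ hv); have [va vg wv] := hw_K_highest hv.
  have w_b := K_weight_Y_b wv; split.
  + push_linear; rewrite (X_a_Y_a w_b); solve_highest va vg.
  + push_linear; solve_highest va vg.
  + solve_weights.
- rewrite (hact_hw _ hv).
  exists (act (Y_b R) v), 0; push_linear; module_ring.
- have [_ _ wv] := hw_K_highest hv; solve_weights.
Qed.

Lemma B_bg_shift :
  shift_operator (B_bg act) (Y_bg R) (fun a c => c + 1) 1 (-2) (-1).
Proof.
rewrite /B_bg; split => [|n k m v hv|n k m v hv|n k m v hv].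
- solve_additive.
- rewrite (hact_hw _ hv); have [va vg wv] := hw_K_highest hv.
  have w_b := K_weight_Y_b wv; split.
  + push_linear; solve_highest va vg.
  + push_linear; rewrite (X_g_Y_g w_b); solve_highest va vg.
  + solve_weights.
- rewrite (hact_hw _ hv).
  exists 0, (- act (Y_b R) v); push_linear; module_ring.
- have [_ _ wv] := hw_K_highest hv; solve_weights.
Qed.

Lemma B_abg_shift :
  shift_operator (B_abg act) (Y_abg R) (fun a c => (a + 1) * (c + 1))
    (-1) (-2) (-1).
Proof.
rewrite /B_abg; split => [|n k m v hv|n k m v hv|n k m v hv].
- solve_additive.
- rewrite !(hact_hw _ hv); have [va vg wv] := hw_K_highest hv.
  have w_b := K_weight_Y_b wv; have w_ab := K_weight_Y_ab wv.
  have w_bg := K_weight_Y_bg wv; have w_g := K_weight_Y_g w_b; split.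
  + push_linear; rewrite (X_a_Y_a w_bg) (X_a_Y_a w_g); solve_highest va vg.
  + push_linear; rewrite !root_commutators (X_g_Y_g w_ab) (X_g_Y_g w_b).
    by push_linear; solve_highest va vg.
  + solve_weights.
- rewrite !(hact_hw _ hv).
  exists ((m%:R + 1) *: act (Y_bg R) v - act (Y_g R) (act (Y_b R) v)).
  exists (- ((n%:R + 1) *: act (Y_ab R) v)); push_linear; module_ring.
- have [_ _ wv] := hw_K_highest hv; solve_weights.
Qed.

End UnitaryModule.

Theorem proposition10 (R : realType) (V : lmodType R[i])
    (act kact : 'M[R[i]]_4 -> {linear V -> V})
    (form : {dot V for (@Num.conj R[i])})
    (unitaryV : unitary_gK_module act kact form) :
  [/\ adjoint_on_Vplus act form (A_b act)
        (fun v => - B_b act (hact act (fun a c => (a + 2) * (c + 2)) v))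
    & adjoint_on_Vplus act form (B_b act)
        (fun v => - A_b act (hact act (fun a c => 1 / ((a + 1) * (c + 1))) v))]
  /\
  [/\ adjoint_on_Vplus act form (A_ab act)
        (fun v => - B_ab act (hact act (fun a c => (c + 2) / (a + 1)) v))
    & adjoint_on_Vplus act form (B_ab act)
        (fun v => - A_ab act (hact act (fun a c => (a + 2) / (c + 1)) v))]
  /\
  [/\ adjoint_on_Vplus act form (A_bg act)
        (fun v => - B_bg act (hact act (fun a c => (a + 2) / (c + 1)) v))
    & adjoint_on_Vplus act form (B_bg act)
        (fun v => - A_bg act (hact act (fun a c => (c + 2) / (a + 1)) v))]
  /\
  [/\ adjoint_on_Vplus act form (A_abg act)
        (fun v => - B_abg act (hact act (fun a c => 1 / ((a + 1) * (c + 1))) v))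
    & adjoint_on_Vplus act form (B_abg act)
        (fun v => - A_abg act (hact act (fun a c => (a + 2) * (c + 2)) v))].
Proof.
have real1 (n : nat) : ((n%:R : R[i]) + 1)^*%R = n%:R + 1.
  by rewrite rmorphD rmorph1 rmorph_nat.
have real2 (n m : nat) :
    (((n%:R : R[i]) + 1) * (m%:R + 1))^*%R = (n%:R + 1) * (m%:R + 1).
  by rewrite rmorphM /= !real1.
have nz (n : nat) : (n%:R : R[i]) + 1 != 0 by rewrite natr1 pnatr_eq0.
(* a coordinate shifted by -1 has n = n' + 1, so f is rewritten in n' and m' *)
have down (n n' : nat) : n'%:Z = n%:Z + (-1) -> (n%:R : R[i]) = n'%:R + 1.
  by move=> e; have -> : n = n'.+1 by [lia]; rewrite -natr1.
split; [|split; [|split]]; split.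
- apply: (shift_adjoint unitaryV (A_b_shift unitaryV) (B_b_shift unitaryV)).
  + by move=> v w; rewrite /Y_b -tr_E (form_noncompact unitaryV).
  + by move=> n m; rewrite real2.
  + by move=> n m n' m' /down -> /down ->; ring.
- apply: (shift_adjoint unitaryV (B_b_shift unitaryV) (A_b_shift unitaryV)).
  + by move=> v w; rewrite /Y_b -tr_E (form_noncompact unitaryV).
  + by move=> n m; rewrite rmorph1.
  + by move=> n m n' m' _ _; field; rewrite !nz.
- apply: (shift_adjoint unitaryV (A_ab_shift unitaryV) (B_ab_shift unitaryV)).
  + by move=> v w; rewrite /Y_ab -tr_E (form_noncompact unitaryV).
  + by move=> n m; rewrite real1.
  + by move=> n m n' m' _ /down ->; field; rewrite !nz.
- apply: (shift_adjoint unitaryV (B_ab_shift unitaryV) (A_ab_shift unitaryV)).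
  + by move=> v w; rewrite /Y_ab -tr_E (form_noncompact unitaryV).
  + by move=> n m; rewrite real1.
  + by move=> n m n' m' /down -> _; field; rewrite !nz.
- apply: (shift_adjoint unitaryV (A_bg_shift unitaryV) (B_bg_shift unitaryV)).
  + by move=> v w; rewrite /Y_bg -tr_E (form_noncompact unitaryV).
  + by move=> n m; rewrite real1.
  + by move=> n m n' m' /down -> _; field; rewrite !nz.
- apply: (shift_adjoint unitaryV (B_bg_shift unitaryV) (A_bg_shift unitaryV)).
  + by move=> v w; rewrite /Y_bg -tr_E (form_noncompact unitaryV).
  + by move=> n m; rewrite real1.
  + by move=> n m n' m' _ /down ->; field; rewrite !nz.
- apply: (shift_adjoint unitaryV (A_abg_shift unitaryV) (B_abg_shift unitaryV)).
  + by move=> v w; rewrite /Y_abg -tr_E (form_noncompact unitaryV).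
  + by move=> n m; rewrite rmorph1.
  + by move=> n m n' m' _ _; field; rewrite !nz.
- apply: (shift_adjoint unitaryV (B_abg_shift unitaryV) (A_abg_shift unitaryV)).
  + by move=> v w; rewrite /Y_abg -tr_E (form_noncompact unitaryV).
  + by move=> n m; rewrite real2.
  + by move=> n m n' m' /down -> /down ->; ring.
Qed.
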